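(* For every $\rho\in\mathfrak{M}_L^1(\mathbb{R}^d)$, $\Upsilon_{-2,2}(\mathcal{A}_1(\rho))=\mathcal{A}_1(\Upsilon^0(\rho))$.
   Context: A Lévy measure on $\mathbb{R}^d$ is a measure $\nu$ with $\nu(\{0\})=0$ and $\int(1\wedge|x|^2)\nu(\mathrm{d}x)<\infty$; $\mathfrak{M}_L^1(\mathbb{R}^d)$ is the class of those with $\int(1\wedge|x|)\nu(\mathrm{d}x)<\infty$. $a_1(r;s)=2\pi^{-1}(s-r^2)^{-1/2}$ for $0<r<s^{1/2}$, $0$ otherwise; $\mathcal{A}_1(\nu)(B)=\int_{\mathbb{R}^d\setminus\{0\}}\nu(\mathrm{d}x)\int_0^\infty a_1(r;|x|)1_B(rx/|x|)\mathrm{d}r$. $\Upsilon^0(\nu)(B)=\int_0^\infty\nu(u^{-1}B)e^{-u}\mathrm{d}u$ and $\Upsilon_{-2,2}(\nu)(B)=\int_0^\infty\nu(s^{-1}B)\,2se^{-s^2}\mathrm{d}s$, where $u^{-1}B=\{u^{-1}x:x\in B\}$. *)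

(* Defs.v *)
(* R^d is modelled as d.-tuple R, whose canonical
   sigma-algebra (measurable_tuple) is the one generated by the coordinate
   maps, i.e. the product = Borel sigma-algebra of R^d. *)
From HB Require Import structures.
From mathcomp Require Import all_boot all_order all_algebra.
From mathcomp Require Import all_classical all_reals all_analysis.
Set Implicit Arguments. Unset Strict Implicit. Unset Printing Implicit Defensive.
Import Order.TTheory GRing.Theory Num.Theory.
Import numFieldNormedType.Exports.
Local Open Scope classical_set_scope.
Local Open Scope ring_scope.

Section Defs.
Variables (R : realType) (d : nat).

Definition enorm (x : d.-tuple R) : R := Num.sqrt (\sum_(i < d) tnth x i ^+ 2).

Definition tscale (c : R) (x : d.-tuple R) : d.-tuple R := map_tuple ( *%R c) x.

Definition tzero : d.-tuple R := [tuple of nseq d 0].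

Definition invscale_set (u : R) (B : set (d.-tuple R)) : set (d.-tuple R) :=
  [set tscale u^-1 x | x in B].

Definition a1 (r s : R) : R :=
  if (0 < r) && (r < Num.sqrt s) then 2 / pi * (Num.sqrt (s - r ^+ 2))^-1 else 0.

Local Open Scope ereal_scope.

Definition A1 (nu : set (d.-tuple R) -> \bar R) (B : set (d.-tuple R)) : \bar R :=
  \int[nu]_(x in [set x | x <> tzero])
     \int[lebesgue_measure]_(r in `[0%R, +oo[)
        ((a1 r (enorm x))%:E * (\1_B (tscale (r / enorm x) x))%:E).

Definition Upsilon0 (nu : set (d.-tuple R) -> \bar R) (B : set (d.-tuple R)) : \bar R :=
  \int[lebesgue_measure]_(u in `]0%R, +oo[) (nu (invscale_set u B) * (expR (- u))%:E).

Definition Upsilon_m22 (nu : set (d.-tuple R) -> \bar R) (B : set (d.-tuple R)) : \bar R :=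
  \int[lebesgue_measure]_(s in `]0%R, +oo[)
     (nu (invscale_set s B) * (2 * s * expR (- s ^+ 2))%:E).

Definition levy_measure (nu : {measure set (d.-tuple R) -> \bar R}) : Prop :=
  nu [set tzero] = 0 /\
  \int[nu]_(x in setT) (Num.min 1 (enorm x ^+ 2))%:E < +oo.

Definition levy_measure_L1 (nu : {measure set (d.-tuple R) -> \bar R}) : Prop :=
  levy_measure nu /\ \int[nu]_(x in setT) (Num.min 1 (enorm x))%:E < +oo.

End Defs.

(* Main.v *)
Require Import Defs.
From HB Require Import structures.
From mathcomp Require Import all_boot all_order all_algebra.
From mathcomp Require Import all_classical all_reals all_analysis.
From mathcomp Require Import measurable_realfun ring.
Import Order.TTheory GRing.Theory Num.Theory.
Import numFieldNormedType.Exports.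
Local Open Scope classical_set_scope.
Local Open Scope ring_scope.

(* Let [k x] be the integral of [a1 r |x| * 1_B (r x / |x|)] over [r], so that
   [A1 nu B] is the [nu]-integral of [k], and let [G u] be the [rho]-integral of
   [k (u x)] over [x]. The identity [s * a1 (s r) (s^2 c) = a1 r c] turns the
   left-hand side into the integral of [G (s^2) 2 s e^(-s^2)] over [s > 0].
   By Tonelli, which applies because [rho] is sigma-finite, the right-hand side
   is the integral of [G u e^(-u)] over [u > 0], and [u = s^2] matches the two. *)

(** * Measures with a density and their images *)

Section density.
Local Open Scope ereal_scope.
Context {d : measure_display} {T : measurableType d} {R : realType}.
Variables (mu : {measure set T -> \bar R}) (w : T -> R).
Hypotheses (mw : measurable_fun setT w) (w0 : forall x, (0 <= w x)%R).

(** The two proofs are arguments so that they can be read off the term when the measure structure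
    declared below is inferred. *)
Definition density & measurable_fun setT w & forall x, (0 <= w x)%R :=
  fun A => \int[mu]_(x in A) (w x)%:E.

Local Notation nu := (density mw w0).

Let density0 : nu set0 = 0.
Proof. by rewrite /density integral_set0. Qed.

Let density_ge0 A : 0 <= nu A.
Proof. by apply: integral_ge0 => x _; rewrite lee_fin. Qed.

Let density_sigma_additive : semi_sigma_additive nu.
Proof.
move=> /= F mF tF mUF; rewrite /density; apply: cvg_toP.
  apply: ereal_nondecreasing_is_cvgn => m n mn.
  by apply: lee_sum_nneg_natr => // k _ _; exact: density_ge0.
rewrite ge0_integral_bigcup//=.
  by apply/measurable_EFinP; exact: measurable_funTS.
by move=> x _; rewrite lee_fin.
Qed.

HB.instance Definition _ := isMeasure.Build _ _ _ nu
  density0 density_ge0 density_sigma_additive.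

Import HBNNSimple.

Let ge0_integral_density_nnsfun (f : {nnsfun T >-> R}) :
  \int[nu]_x (f x)%:E = \int[mu]_x ((f x)%:E * (w x)%:E).
Proof.
rewrite integralT_nnsfun sintegralE.
under [RHS]eq_integral.
  move=> x xD; rewrite fimfunE -fsumEFin// muleC ge0_mule_fsumr; last first.
    by move=> r; exact: nnfun_muleindic_ge0.
  over.
rewrite [RHS]ge0_integral_fsum//; last 2 first.
  - move=> r; apply: emeasurable_funM; first exact/measurable_EFinP.
    by apply/measurable_EFinP; apply/measurableT_comp => //.
  - by move=> r x _; apply: mule_ge0; [rewrite lee_fin|exact: nnfun_muleindic_ge0].
apply: eq_fsbigr => r /[!inE] fr; rewrite /= /density integral_mkcond.
have r0 : (0 <= r)%R by case: fr => x _ <-.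
rewrite -ge0_integralZl//; last 2 first.
  - apply/(measurable_restrictT _ _).1; first exact: measurable_sfunP.
    by apply/measurable_EFinP; exact: measurable_funTS.
  - by move=> x _; rewrite patchE; case: ifPn => // _; rewrite lee_fin.
apply: eq_integral => x _; rewrite patchE indicE.
by case: ifPn => _ /=; rewrite ?mulr1 ?mulr0 ?mule0// muleC.
Qed.

(** Monotone convergence along [nnsfun_approx] extends the case of simple functions; multiplying by
    [w], which is nonnegative, keeps the approximations increasing. *)
Lemma ge0_integral_density (f : T -> \bar R) :
  measurable_fun setT f -> (forall x, 0 <= f x) ->
  \int[nu]_x f x = \int[mu]_x (f x * (w x)%:E).
Proof.
move=> mf f0; pose f_ := nnsfun_approx measurableT mf.
transitivity (lim (\int[nu]_x (f_ n x)%:E @[n --> \oo])).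
  rewrite -monotone_convergence//=.
  - apply: eq_integral => x _; apply/esym/cvg_lim => //=.
    exact: cvg_nnsfun_approx.
  - by move=> n; exact/measurable_EFinP.
  - by move=> n x _; rewrite lee_fin.
  - by move=> x _ m n mn; rewrite lee_fin; exact/lefP/nd_nnsfun_approx.
under eq_fun do rewrite ge0_integral_density_nnsfun.
rewrite -monotone_convergence//=.
- apply: eq_integral => x _; apply/cvg_lim => //=.
  by apply: cvgeZr => //; exact: cvg_nnsfun_approx.
- by move=> n; apply: emeasurable_funM; exact/measurable_EFinP.
- by move=> n x _; rewrite mule_ge0 ?lee_fin.
- move=> x _ m n mn; rewrite lee_wpmul2r ?lee_fin//.
  exact/lefP/nd_nnsfun_approx.
Qed.

End density.

(** Common source of the substitutions [r |-> c * r] and [s |-> s ^+ 2] and of the mixture of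
    dilations behind [Upsilon0]. Only the values and the integrals of the image measure are
    exposed. *)
Lemma pushforward_density {d1 d2 : measure_display}
    {T1 : measurableType d1} {T2 : measurableType d2} {R : realType}
    (mu : {measure set T1 -> \bar R}) (w : T1 -> R) (phi : T1 -> T2) :
  measurable_fun setT w -> (forall x, 0 <= w x) -> measurable_fun setT phi ->
  exists P : {measure set T2 -> \bar R},
    (forall A, P A = \int[mu]_(x in phi @^-1` A) (w x)%:E)%E /\
    (forall f : T2 -> \bar R,
      measurable_fun setT f -> (forall y, 0 <= f y)%E ->
      \int[P]_y f y = \int[mu]_x (f (phi x) * (w x)%:E))%E.
Proof.
move=> mw w0 mphi.
unshelve eexists (pushforward (density mu w mw w0) phi : {measure set T2 -> \bar R}).
  exact: mphi.
split=> // f mf f0; rewrite ge0_integral_pushforward// preimage_setT.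
rewrite ge0_integral_density//; first exact: measurableT_comp.
by move=> x; exact: f0.
Qed.

Section eq_set_fun_integral.
Import HBNNSimple.

(* [Upsilon0 nu] is a measure only on measurable sets, so that
   [eq_measure_integral] does not apply to it. *)
Lemma eq_set_fun_integral {d : measure_display} {T : measurableType d}
    {R : realType} (m1 m2 : set T -> \bar R) (D : set T) (f : T -> \bar R) :
  (forall A, measurable A -> m1 A = m2 A) ->
  (\int[m1]_(x in D) f x = \int[m2]_(x in D) f x)%E.
Proof.
move=> m12.
have E (h : {nnsfun T >-> R}) : sintegral m1 h = sintegral m2 h.
  rewrite /sintegral; apply: eq_fsbigr => r _; congr (_ * _)%E.
  by rewrite m12.
rewrite /integral; congr (ereal_sup _ - ereal_sup _)%E;
  by apply/seteqP; split => _ [h hf <-]; exists h => //; rewrite E.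
Qed.

End eq_set_fun_integral.

(** * Substitutions on the real line *)

Lemma ge0_integral_scale {R : realType} (c : R) (f : R -> \bar R) :
  0 < c -> measurable_fun setT f -> (forall r, (0 <= f r)%E) ->
  (\int[lebesgue_measure]_r f r =
   \int[lebesgue_measure]_r (f (c * r)%R * c%:E))%E.
Proof.
move=> c0 mf f0.
have mc : measurable_fun setT (fun _ : R => c) by exact: measurable_cst.
have mZ : measurable_fun setT (fun r : measurableTypeR R => c * r : measurableTypeR R).
  exact: mulrl_measurable.
have [P [PE PI]] := pushforward_density lebesgue_measure _ _ mc
  (fun=> ltW c0) mZ.
(* [P] is the image of [c dr] under [r |-> c * r]. It gives []a, b]] the mass
   [c * (b / c - a / c) = b - a], hence is Lebesgue measure. *)
rewrite -PI//; apply: eq_measure_integral => A mA _.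
apply: lebesgue_measure_unique => // _ [[a b]] _ <-.
rewrite PE/= [X in integral _ X _](_ : _ =
  `]a / c, b / c]%classic); last first.
  apply/seteqP; split => r /=; rewrite !in_itv/= => /andP[];
    rewrite ltr_pdivrMr// ler_pdivlMr// mulrC => -> //=.
rewrite integral_cst//= !lebesgue_measure_itv/= !lte_fin ltr_pM2r ?invr_gt0//.
case: ifPn => _; rewrite ?mule0// -!EFinB -EFinM; congr EFin.
by field; rewrite gt_eqF.
Qed.

(** For negative endpoints the default value 0 of [Num.sqrt] keeps both sides in agreement, because
    [s] is positive. *)
Lemma preimage_sqr_itvoc {R : realType} (a b s : R) :
  0 < s -> (s ^+ 2 \in `]a, b]) = (s \in `]Num.sqrt a, Num.sqrt b]).
Proof.
move=> s0; rewrite !in_itv/=; congr (_ && _).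
- have [a0|a0] := leP 0 a; first by rewrite -ltr_sqrt ?exprn_gt0// sqrtr_sqr gtr0_norm.
  by rewrite ltr0_sqrtr// s0 (lt_trans a0)// exprn_gt0.
- have [b0|b0] := leP 0 b; first by rewrite -ler_sqrt// sqrtr_sqr gtr0_norm.
  rewrite ltr0_sqrtr// [RHS]leNgt s0; apply/negbTE.
  by rewrite -ltNge (lt_trans b0)// exprn_gt0.
Qed.

Lemma integral_double_itvoc {R : realType} (a b : R) : a <= b ->
  (\int[lebesgue_measure]_(s in `]a, b]) (2 * s)%:E = (b ^+ 2 - a ^+ 2)%:E)%E.
Proof.
move=> ab.
have c2 : continuous (fun s : R => 2 * s) by exact: mulrl_continuous.
rewrite integral_itv_obnd_cbnd; last first.
  by apply/measurable_funTS/measurable_EFinP; exact: continuous_measurable_fun.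
move: ab; rewrite le_eqVlt => /predU1P[->|ab].
  by rewrite set_itv1 integral_set1 subrr.
rewrite (@continuous_FTC2 _ _ (fun s => s ^+ 2))//.
- exact: continuous_subspaceT.
- have cX : continuous (fun s : R => s ^+ 2) by exact: exprn_continuous.
  split => //.
  + exact/cvg_at_right_filter/cX.
  + exact/cvg_at_left_filter/cX.
- by move=> x _; rewrite exp_derive1 expr1.
Qed.

(** The image of [2 s ds], [s > 0], under squaring is Lebesgue measure on the positive half line.
    The weight [w] is cut off at 0 so that negative [s], which have the same squares, do not
    count. *)
Lemma ge0_integral_sqr {R : realType} (f : R -> \bar R) :
  measurable_fun setT f -> (forall u, (0 <= f u)%E) ->
  (\int[lebesgue_measure]_(s in `]0%R, +oo[) (f (s ^+ 2)%R * (2 * s)%:E) =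
   \int[lebesgue_measure]_(u in `]0%R, +oo[) f u)%E.
Proof.
move=> mf f0.
pose w (s : R) := 2 * Num.max s 0.
have mw : measurable_fun setT w.
  by apply: measurable_funM => //; exact: measurable_maxr.
have w0 s : 0 <= w s by rewrite mulr_ge0// le_max lexx orbT.
have mX : measurable_fun setT
    (fun s : measurableTypeR R => s ^+ 2 : measurableTypeR R).
  exact: exprn_measurable.
have [P [PE PI]] := pushforward_density lebesgue_measure _ _ mw w0 mX.
have mN : measurable (`]-oo, 0%R]%classic : set (measurableTypeR R)).
  exact: measurable_itv.
(* [lebesgue_measure_unique] compares measures on the whole line, so [P] is completed by Lebesgue
   measure on []-oo, 0]], which does not charge [u > 0]. *)
pose Q : {measure set (measurableTypeR R) -> \bar R} :=
  measure_add P (mrestr lebesgue_measure mN).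
have QD A : Q A = (P A + mrestr lebesgue_measure mN A)%E by exact: measure_addE.
have QE A : measurable A -> lebesgue_measure A = Q A.
  apply: lebesgue_measure_unique => // _ [[a b]] _ <-.
  rewrite QD.
  have [ab|ba] := leP a b; last first.
    by rewrite set_itv_ge ?bnd_simp ?measure0 ?adde0// -leNgt ltW.
  have -> : P `]a, b]%classic =
      (Num.sqrt b ^+ 2 - Num.sqrt a ^+ 2)%:E.
    rewrite -integral_double_itvoc ?ler_wsqrtr// PE.
    rewrite integral_mkcond [RHS]integral_mkcond; apply: eq_integral => s _.
    rewrite !patchE -[s \in _ @^-1` _]/(s ^+ 2 \in [set` `]a, b]]) !mem_setE.
    have [s0|s0] := ltP 0 s.
      rewrite preimage_sqr_itvoc// /w max_l// ltW//.
    rewrite /w max_r// mulr0 if_same ifF//.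
    apply/negbTE; rewrite in_itv/= negb_and -leNgt.
    by rewrite (le_trans s0)// sqrtr_ge0.
  have -> : mrestr lebesgue_measure mN `]a, b]%classic =
      (Num.min b 0 - Num.min a 0)%:E.
    rewrite /mrestr (_ : _ `&` _ = `]Num.min a 0, Num.min b 0]%classic).
      rewrite lebesgue_measure_itv/= lte_fin EFinB.
      case: ltP => // h; have -> : Num.min b 0 = Num.min a 0.
        by apply/eqP; rewrite eq_le h le_min !ge_min ab lexx orbT.
      by rewrite -EFinB subrr.
    apply/seteqP; split => r /=; rewrite !in_itv/=.
      by move=> [/andP[ar rb] r0]; rewrite gt_min ar le_min rb r0.
    rewrite gt_min le_min => /andP[/orP[->|r0]/andP[-> //]].
    by rewrite leNgt r0.
  rewrite lebesgue_measure_itv/= lte_fin -[RHS]EFinD.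
  (* The square of [Num.sqrt x] is the positive part of [x] and [Num.min x 0] is the rest, so the
     two masses add up to [b - a]. *)
  have sqE (x : R) : Num.sqrt x ^+ 2 + Num.min x 0 = x.
    have [x0|x0] := leP 0 x; first by rewrite sqr_sqrtr// addr0.
    by rewrite ltr0_sqrtr// expr0n/= add0r.
  have -> : Num.sqrt b ^+ 2 - Num.sqrt a ^+ 2 + (Num.min b 0 - Num.min a 0) = b - a.
    rewrite -[in RHS](sqE a) -[in RHS](sqE b); ring.
  case: ltP => [//|ba]; have -> : a = b by apply/eqP; rewrite eq_le ab ba.
  by rewrite subrr.
transitivity (\int[P]_(u in `]0%R, +oo[) f u)%E; last first.
  apply: eq_measure_integral => A mA A0; transitivity (Q A); last exact/esym/QE.
  rewrite QD.
  rewrite -[LHS]adde0; congr (_ + _)%E; apply/esym.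
  rewrite /= /mrestr (_ : _ `&` _ = set0) ?measure0// -subset0 => r /= [/A0/=].
  by rewrite !in_itv/= andbT => + r0; rewrite ltNge r0.
rewrite [RHS]integral_mkcond PI//; last 2 first.
- by apply/(measurable_restrictT _ _).1 => //; exact: measurable_funTS.
- by move=> y; rewrite patchE; case: ifPn.
rewrite [LHS]integral_mkcond. congr (integral _ _ _); apply/funext => s.
rewrite !patchE !mem_setE/= !in_itv/= !andbT /w; case: ifPn => s0.
  by rewrite exprn_gt0// max_l// ltW.
by rewrite max_r ?mulr0 ?mule0// leNgt.
Qed.

(** * Norm, dilations and the arcsine density *)

Lemma measurable_funV {d : measure_display} {T : measurableType d}
    {R : realType} (f : T -> R) :
  measurable_fun setT f -> measurable_fun setT (fun x => (f x)^-1).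
Proof.
move=> mf.
(* [powR] with exponent -1 is measurable and inverts nonnegative numbers, whence the square. At
   zeros of [f] both sides are 0 since [0^-1 = 0]. *)
rewrite (_ : (fun x => _) = (fun x => f x * (f x ^+ 2) `^ (-1))).
  apply: measurable_funM => //; apply: (measurableT_comp (measurable_powR _)).
  exact: measurable_funX.
apply/funext => x; rewrite powR_inv1 ?sqr_ge0//.
have [->|fx0] := eqVneq (f x) 0; first by rewrite invr0 mul0r.
by rewrite expr2 invfM mulVKf.
Qed.

Lemma measurable_sqrt {R : realType} : measurable_fun setT (@Num.sqrt R).
Proof. by apply: continuous_measurable_fun; exact: sqrt_continuous. Qed.

Section scaling.
Context {R : realType} {d : nat}.
Local Notation T := (d.-tuple R).
Implicit Types (x : T) (c u s r : R) (B : set T).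

Lemma measurable_enorm : measurable_fun setT (@enorm R d).
Proof.
apply: (measurableT_comp measurable_sqrt); apply: measurable_sum => i.
by apply: measurable_funX; exact: measurable_tnth.
Qed.

Lemma measurable_tscale {d0 : measure_display} {S : measurableType d0}
    (g : S -> R) (h : S -> T) :
  measurable_fun setT g -> measurable_fun setT h ->
  measurable_fun setT (fun z => tscale (g z) (h z)).
Proof.
move=> mg mh; apply/measurable_fun_tnthP => i.
rewrite (_ : _ \o _ = (fun z => g z * tnth (h z) i)); last first.
  by apply/funext => z /=; rewrite tnth_map.
apply: measurable_funM => //.
exact: (measurableT_comp (measurable_tnth i)).
Qed.

Lemma tscaleA c u x : tscale c (tscale u x) = tscale (c * u) x.
Proof. by apply: eq_from_tnth => i; rewrite !tnth_map mulrA. Qed.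

Lemma tscale1 x : tscale 1 x = x.
Proof. by apply: eq_from_tnth => i; rewrite tnth_map mul1r. Qed.

Lemma enormZ c x : 0 <= c -> enorm (tscale c x) = c * enorm x.
Proof.
move=> c0; rewrite /enorm -{2}(ger0_norm c0) -sqrtr_sqr -sqrtrM ?sqr_ge0//.
congr Num.sqrt; rewrite mulr_sumr; apply: eq_bigr => i _.
by rewrite tnth_map exprMn.
Qed.

Lemma enorm_ge0 x : 0 <= enorm x.
Proof. exact: sqrtr_ge0. Qed.

Lemma enorm_eq0 x : enorm x = 0 -> x = tzero R d.
Proof.
move/eqP; rewrite sqrtr_eq0 => le0; apply: eq_from_tnth => i.
have /eqP : \sum_(i < d) tnth x i ^+ 2 = 0.
  by apply/eqP; rewrite eq_le le0 sumr_ge0// => j _; exact: sqr_ge0.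
rewrite psumr_eq0; last by move=> j _; exact: sqr_ge0.
move=> /allP/(_ i (mem_index_enum _)); rewrite sqrf_eq0 => /eqP ->.
by rewrite (tnth_nth 0) nth_nseq if_same.
Qed.

Lemma enorm0 : enorm (tzero R d) = 0.
Proof.
rewrite /enorm big1 ?sqrtr0// => i _.
by rewrite (tnth_nth 0) nth_nseq if_same expr0n.
Qed.

(** As a preimage, the set has an evident indicator, and its measurability follows by
    composition. *)
Lemma invscale_setE u B : 0 < u -> invscale_set u B = tscale u @^-1` B.
Proof.
move=> u0; apply/seteqP; split => [_ [x Bx <-]|x Bx] /=.
  by rewrite tscaleA divff ?gt_eqF// tscale1.
by exists (tscale u x) => //; rewrite tscaleA mulVf ?gt_eqF// tscale1.
Qed.

Lemma a1_ge0 r s : 0 <= a1 r s.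
Proof.
by rewrite /a1; case: ifP => // _; rewrite !mulr_ge0 ?invr_ge0 ?sqrtr_ge0 ?pi_ge0.
Qed.

Lemma a1_le0 r s : r <= 0 -> a1 r s = 0.
Proof. by move=> r0; rewrite /a1 ltNge r0. Qed.

Lemma a1_r0 r : a1 r 0 = 0.
Proof. by rewrite /a1 sqrtr0 -(andbC (r < 0)) lt_asym. Qed.

(** By [sqrt (s^2 y) = s sqrt y] the cutoff scales like [r], and the inverse square root loses a
    factor [s], restored by the Jacobian of [r |-> s * r]. *)
Lemma a1_scale s r c : 0 < s -> a1 (s * r) (s ^+ 2 * c) * s = a1 r c.
Proof.
move=> s0; have sqrtE y : Num.sqrt (s ^+ 2 * y) = s * Num.sqrt y.
  by rewrite sqrtrM ?sqr_ge0// sqrtr_sqr gtr0_norm.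
rewrite /a1 pmulr_rgt0// exprMn -mulrBr !sqrtE ltr_pM2l//.
case: ifP => _; last by rewrite mul0r.
by rewrite -[LHS]mulrA; congr (_ * _); rewrite invfM mulrAC mulVf ?gt_eqF// mul1r.
Qed.

Lemma measurable_a1 {d0 : measure_display} {S : measurableType d0}
    (f g : S -> R) :
  measurable_fun setT f -> measurable_fun setT g ->
  measurable_fun setT (fun z => a1 (f z) (g z)).
Proof.
move=> mf mg; apply: measurable_fun_ifT => //.
  apply: measurable_and; apply: measurable_fun_ltr => //.
  exact: (measurableT_comp measurable_sqrt).
apply: measurable_funM => //; apply: measurable_funV.
apply: (measurableT_comp measurable_sqrt); apply: measurable_funB => //.
exact: measurable_funX.
Qed.

End scaling.

(** * The arcsine transform as integration of a kernel *)

Section transforms.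
Context {R : realType} {d : nat}.
Local Notation T := (d.-tuple R).
Local Notation leb := (@lebesgue_measure R).
Implicit Types (x : T) (u s r : R) (B : set T) (nu : {measure set T -> \bar R}).

Let h B x r : \bar R :=
  ((a1 r (enorm x))%:E * (\1_B (tscale (r / enorm x) x))%:E)%E.

Let h_ge0 B x r : (0 <= h B x r)%E.
Proof. by rewrite mule_ge0 ?lee_fin ?a1_ge0. Qed.

Let measurable_h B : measurable B ->
  measurable_fun setT (fun z : T * measurableTypeR R => h B z.1 z.2).
Proof.
move=> mB.
have m1 : measurable_fun setT (fun z : T * measurableTypeR R => enorm z.1).
  exact: (measurableT_comp measurable_enorm).
apply: emeasurable_funM; apply/measurable_EFinP.
  exact: measurable_a1.
apply: (measurableT_comp (measurable_indic mB)).
apply: measurable_tscale => //; apply: measurable_funM => //.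
exact: measurable_funV.
Qed.

(* The arcsine transform of [nu] at [B] is the [nu]-integral of this function:
   [a1 r _] vanishes for [r <= 0] and [a1 _ 0 = 0], so both the half line and
   the punctured space can be replaced by the full spaces. *)
Definition arcsine_kernel B x : \bar R := (\int[leb]_r h B x r)%E.

Lemma arcsine_kernel_ge0 B x : (0 <= arcsine_kernel B x)%E.
Proof. by apply: integral_ge0 => r _; exact: h_ge0. Qed.

Lemma measurable_arcsine_kernel B :
  measurable B -> measurable_fun setT (arcsine_kernel B).
Proof.
move=> mB; have mh := measurable_h _ mB.
exact: (measurable_fun_fubini_tonelli_F _ mh (fun z => h_ge0 B z.1 z.2)).
Qed.

Lemma A1E (nu : set T -> \bar R) B :
  A1 nu B = (\int[nu]_x arcsine_kernel B x)%E.
Proof.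
have kE x : (\int[leb]_(r in `[0%R, +oo[) h B x r = arcsine_kernel B x)%E.
  rewrite integral_mkcond; congr (integral _ _ _); apply/funext => r.
  rewrite patchE mem_setE in_itv/= andbT; case: ifPn => // r0.
  by rewrite /h a1_le0 ?mul0e// ltW// ltNge.
(* [nu] is a mere set function here, so that the lemma covers [Upsilon0 rho]; the restriction of the
   domain is therefore read off the definition of the integral. *)
have mkcond D f : (\int[nu]_(x in D) f x = \int[nu]_x (f \_ D) x)%E.
  by rewrite /integral patch_setT.
rewrite /A1 mkcond; congr (integral _ _ _); apply/funext => x.
rewrite patchE kE; case: ifPn => // /negP x0.
have -> : x = tzero R d by apply: contrapT => xN0; apply: x0; rewrite inE.
rewrite /arcsine_kernel integral0_eq// => r _.
by rewrite /h enorm0 a1_r0 mul0e.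
Qed.

(** After substituting [s * r] for [r] on the right, [a1_scale] with [c = enorm x] absorbs the
    Jacobian. The point [s r x / |x|] is in [B] exactly when [r x / |x|] is in [s^-1 B]. *)
Lemma arcsine_kernel_scale B s x : measurable B -> 0 < s ->
  arcsine_kernel (invscale_set s B) x = arcsine_kernel B (tscale (s ^+ 2) x).
Proof.
move=> mB s0; rewrite /arcsine_kernel [RHS](ge0_integral_scale s)//; first last.
  exact: (measurableT_comp (measurable_h _ mB) (pair1_measurable _)).
congr (integral _ _ _); apply/funext => r.
rewrite /h enormZ ?sqr_ge0// [RHS]muleAC -[X in _ = (X * _)%E]EFinM a1_scale//.
rewrite tscaleA.
congr (_ * _%:E)%E; rewrite invscale_setE// !indicE.
rewrite -[_ \in _ @^-1` _]/(tscale s (tscale (r / enorm x) x) \in B) tscaleA.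
congr ((_ \in B)%:R); congr tscale.
(* Only [s ^+ 2] is cancelled: [enorm x] may be 0, and its inverse stands on both sides. *)
rewrite invfM -!mulrA; do 2 congr (_ * _).
by rewrite mulrCA mulVf ?mulr1// expf_eq0 gt_eqF.
Qed.

Lemma Upsilon_m22_A1E nu B : measurable B ->
  Upsilon_m22 (A1 nu) B =
  (\int[leb]_(s in `]0%R, +oo[)
     ((\int[nu]_x arcsine_kernel B (tscale (s ^+ 2) x)) *
       (2 * s * expR (- s ^+ 2))%:E))%E.
Proof.
move=> mB; apply: eq_integral => s; rewrite inE/= in_itv/= andbT => s0.
rewrite A1E; congr (_ * _)%E; congr (integral _ _ _); apply/funext => x.
exact: arcsine_kernel_scale.
Qed.

End transforms.

(** * Integration against [Upsilon0 nu] *)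

Section Upsilon0.
Context {R : realType} {d : nat}.
Local Notation T := (d.-tuple R).
Local Notation leb := (@lebesgue_measure R).
Variable nu : {sigma_finite_measure set T -> \bar R}.

Let measurable_dilation :
  measurable_fun setT (fun z : measurableTypeR R * T => tscale z.1 z.2).
Proof. exact: measurable_tscale. Qed.

Lemma measurable_dilation_integral (f : T -> \bar R) :
  measurable_fun setT f -> (forall x, 0 <= f x)%E ->
  measurable_fun setT
    (fun u : measurableTypeR R => \int[nu]_x f (tscale u x))%E.
Proof.
move=> mf f0; apply: (measurable_fun_fubini_tonelli_F
  (fun z : measurableTypeR R * T => f (tscale z.1 z.2))) => //.
exact: (measurableT_comp mf measurable_dilation).
Qed.

(* On measurable sets [Upsilon0 nu] is the image of the measure
   [e^-u du (x) nu(dx)], [u > 0], under the dilation [(u, x) |-> u x]. *)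
Lemma integral_Upsilon0 (f : T -> \bar R) :
  measurable_fun setT f -> (forall x, 0 <= f x)%E ->
  (\int[Upsilon0 nu]_x f x =
   \int[leb]_(u in `]0%R, +oo[)
      ((\int[nu]_x f (tscale u x)) * (expR (- u))%:E))%E.
Proof.
(* The constraint [u > 0] goes into the weight, so that Tonelli applies on the full product
   space. *)
pose w (z : measurableTypeR R * T) : R := if 0 < z.1 then expR (- z.1) else 0.
have mw : measurable_fun setT w.
  apply: measurable_fun_ifT => //.
    apply: (measurable_fun_ltr (f := fun=> 0)) => //.
  apply: (measurableT_comp (@measurable_expR R)).
  exact: (measurable_funN measurable_fst).
have w0 z : 0 <= w z by rewrite /w; case: ifP => // _; exact: expR_ge0.
have [P [_ PI]] := pushforward_density (leb \x nu)%E _ _ mw w0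
  measurable_dilation.
(* Used twice: for [f], and for indicators, which identifies [P] with [Upsilon0 nu] on measurable
   sets. *)
have PE (g : T -> \bar R) : measurable_fun setT g -> (forall x, 0 <= g x)%E ->
    (\int[P]_x g x = \int[leb]_(u in `]0%R, +oo[)
      ((\int[nu]_x g (tscale u x)) * (expR (- u))%:E))%E.
  move=> mg g0; rewrite PI// (@fubini_tonelli1 _ _ _ _ _ leb nu); last 2 first.
  - apply: emeasurable_funM; last exact/measurable_EFinP.
    exact: (measurableT_comp mg measurable_dilation).
  - by move=> z; rewrite mule_ge0 ?lee_fin.
  rewrite [RHS]integral_mkcond; congr (integral _ _ _); apply/funext => u.
  rewrite patchE mem_setE in_itv/= andbT /fubini_F /w/=; case: ifPn => u0.
    rewrite ge0_integralZr ?lee_fin ?expR_ge0//.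
    exact: (measurableT_comp mg (measurableT_comp measurable_dilation
      (pair1_measurable u))).
  by under eq_integral do rewrite mule0; rewrite integral0.
move=> mf f0; rewrite -PE//; apply: eq_set_fun_integral => A mA.
transitivity (\int[P]_x (\1_A x)%:E)%E; last by rewrite integral_indic// setIT.
rewrite PE//; last exact/measurable_EFinP/measurable_indic.
apply: eq_integral => u; rewrite inE/= in_itv/= andbT => u0.
rewrite invscale_setE//; congr (_ * _)%E.
rewrite -[RHS]/(\int[nu]_x (\1_(tscale u @^-1` A) x)%:E)%E.
rewrite integral_indic ?setIT// -[X in measurable X]setTI.
exact: (measurableT_comp measurable_dilation (pair1_measurable u)).
Qed.

End Upsilon0.

(** * Sigma-finiteness and the conclusion *)

Lemma levy_measure_L1_sigma_finite {R : realType} {d : nat}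
    (rho : {measure set (d.-tuple R) -> \bar R}) :
  levy_measure_L1 rho -> sigma_finite setT rho.
Proof.
move=> [[rho0 _] rho1].
(* On [D n] the integrand [min 1 |x|] is at least [1 / (n + 1)], so [D n] has finite mass by
   Markov's inequality. The origin, a null set, completes the cover. *)
pose D n := [set x : d.-tuple R | n.+1%:R^-1 <= enorm x].
have mD n : measurable (D n).
  rewrite -[D n]setTI; apply: (measurable_fun_ler (f := fun=> _)) => //.
  exact: measurable_enorm.
exists (fun n => [set tzero R d] `|` D n).
  apply/seteqP; split => // x _; have := enorm_ge0 x.
  rewrite le_eqVlt => /predU1P[/esym/enorm_eq0 ->|x0]; first by exists 0%N => //; left.
  (* With this [n], [1 / |x| < n + 1]. *)
  exists (Num.truncn (enorm x)^-1) => //; right; rewrite /D/=.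
  rewrite invf_ple ?posrE ?invr_gt0// ?ltr0Sn//; exact/ltW/truncnS_gt.
move=> n.
have m0 : measurable [set tzero R d].
  rewrite (_ : [set _] = [set x | enorm x == 0]).
    rewrite -[X in measurable X]setTI.
    apply: (measurable_fun_eqr (f := @enorm R d) (g := fun=> 0)) => //.
    exact: measurable_enorm.
  apply/seteqP; split => [x ->|x /eqP/enorm_eq0//] /=; exact/eqP/enorm0.
split; first exact: measurableU.
apply: (le_lt_trans (measureU2 _ m0 (mD n))).
rewrite [X in (X + _)%E]rho0 add0e.
have mmin : measurable_fun setT (fun x : d.-tuple R => (Num.min 1 (enorm x))%:E).
  apply/measurable_EFinP; apply: measurable_minr => //; exact: measurable_enorm.
have min0 (x : d.-tuple R) : (0 <= (Num.min 1 (enorm x))%:E)%E.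
  by rewrite lee_fin le_min ler01 enorm_ge0.
apply: (@le_lt_trans _ _
    (\int[rho]_x (n.+1%:R%:E * (Num.min 1 (enorm x))%:E))%E); last first.
  by rewrite ge0_integralZl// lte_mul_pinfty// lee_fin.
apply: (@le_trans _ _ (\int[rho]_x (\1_(D n) x)%:E)%E).
  by rewrite integral_indic// setIT.
apply: ge0_le_integral => //.
- exact/measurable_EFinP/measurable_indic.
- exact: measurable_funeM.
move=> x _; rewrite indicE; case: (boolP (x \in D n)) => [|_]; last by rewrite mule_ge0.
rewrite inE /D/= -EFinM lee_fin => nx.
by rewrite -ler_pdivrMl// mulr1 le_min nx invf_le1// ler1n.
Qed.

Theorem theorem3p7 (R : realType) (d : nat)
    (rho : {measure set (d.-tuple R) -> \bar R}) :
  levy_measure_L1 rho ->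
  forall B : set (d.-tuple R), measurable B ->
    Upsilon_m22 (A1 rho) B = A1 (Upsilon0 rho) B.
Proof.
move=> /levy_measure_L1_sigma_finite rho_fin B mB.
(* [nu] is [rho] equipped with the sigma-finite structure that [integral_Upsilon0] expects. *)
pose sF := isSigmaFinite.Build _ _ _ _ rho_fin.
pose sf := isSFinite.Build _ _ _ _ (sfinite_measure_sigma_finite rho_fin).
pose nu : {sigma_finite_measure set (d.-tuple R) -> \bar R} :=
  HB.pack_for (SigmaFiniteMeasure.type (d.-tuple R) R) (Measure.sort rho) sf sF.
have mk := measurable_arcsine_kernel B mB.
have k0 := arcsine_kernel_ge0 B.
rewrite Upsilon_m22_A1E// A1E (integral_Upsilon0 nu)//.
rewrite -[RHS]ge0_integral_sqr; last 2 first.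
- apply: emeasurable_funM; first exact: (measurable_dilation_integral nu).
  apply/measurable_EFinP; apply: (measurableT_comp (@measurable_expR R)).
  exact: oppr_measurable.
- move=> u; rewrite mule_ge0 ?lee_fin ?expR_ge0//.
  by apply: integral_ge0 => x _; exact: k0.
by apply: eq_integral => s _; rewrite -muleA -EFinM (mulrC (expR _)).
Qed.
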